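(* Let $\{(X_t,c_t):t\in T\}$ be a family of pairwise disjoint fuzzy closure spaces. The sum $(X,c)=\big(\bigcup_{t\in T}X_t,\oplus c_t\big)$ is a ČF$T_{2\frac12}$ space if and only if each $(X_t,c_t)$ is a ČF$T_{2\frac12}$ space.
   Context: $I=[0,1]$; a fuzzy (sub)set of a non-empty set $X$ is a map $f:X\to I$, and $I^X$ is the set of all of them, ordered pointwise, with $\vee,\wedge$ pointwise supremum/infimum. $\underline 0$ is the constant $0$ fuzzy set; $1_A$ is the characteristic function of $A\subseteq X$; the complement is $\mathfrak{Co}(f)(x)=1-f(x)$. For $x\in X$ and $0<\lambda\le1$, the fuzzy point $x_\lambda$ has value $\lambda$ at $x$ and $0$ elsewhere; $x_\lambda\in f$ means $x_\lambda\le f$, i.e. $\lambda\le f(x)$. Fuzzy points $x_\lambda,y_\gamma$ are distinct if $x\ne y$. A fuzzy closure space is a pair $(X,c)$ with $X$ a non-empty set and $c:I^X\to I^X$ satisfying $c(\underline 0)=\underline 0$, $f\le c(f)$, and $c(f\vee g)=c(f)\vee c(g)$ for all $f,g\in I^X$ (idempotency is not required). Sum: if the sets $X_t$ are pairwise disjoint, $X=\bigcup_{t\in T}X_t$ and $\oplus c_t(f)=\bigvee_{t\in T}c_t(1_{X_t}\wedge f)$ for $f\in I^X$, where $1_{X_t}\wedge f$ is regarded as a fuzzy subset of $X_t$ and $c_t(\cdot)\in I^{X_t}$ is extended by $0$ to $X$. The interior is $\operatorname{int}(f)=\mathfrak{Co}(c(\mathfrak{Co}(f)))$; $f$ is a neighborhood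 of a fuzzy point $x_\lambda$ if $x_\lambda\le\operatorname{int}(f)$. $(X,c)$ is ČF$T_{2\frac12}$ (ČF-Urysohn) if for every two distinct fuzzy points $x_\lambda,y_\gamma$ there are neighborhoods $f$ of $x_\lambda$ and $g$ of $y_\gamma$ such that $c(f)\le\mathfrak{Co}(c(g))$, $x_\lambda\in f\le\mathfrak{Co}(y_\gamma)$ and $y_\gamma\in g\le\mathfrak{Co}(x_\lambda)$. *)

(* Defs.v *)
From HB Require Import structures.
From mathcomp Require Import all_boot all_order all_algebra.
From mathcomp Require Import interval_inference all_classical all_reals.
Set Implicit Arguments.
Unset Strict Implicit.
Unset Printing Implicit Defensive.
Import Order.TTheory GRing.Theory Num.Theory.
Local Open Scope classical_set_scope.
Local Open Scope ring_scope.

(* Fuzzy sets carry the pointwise order and the pointwise lattice operations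
   `&` and `|` that mathcomp.classical.boolp puts on function spaces. *)
Definition fuzzy_set (R : realType) (X : Type) : Type := X -> {i01 R}.

Section FuzzySets.
Variables (R : realType) (X : Type).

Definition fzero : fuzzy_set R X := fun=> 0%:i01.

Definition findic (A : set X) : fuzzy_set R X :=
  fun x => if x \in A then 1%:i01 else 0%:i01.

Definition fcompl (f : fuzzy_set R X) : fuzzy_set R X :=
  fun x => (1 - (f x)%:num)%:i01.

(* A fuzzy point only when 0 < l; CF_Urysohn carries that hypothesis. *)
Definition fpoint (x : X) (l : {i01 R}) : fuzzy_set R X :=
  fun y => if y \in [set x] then l else 0%:i01.

Lemma ubound_i01 (S : set {i01 R}) : ubound [set a%:num | a in S] (1 : R).
Proof. by move=> _ [a _ <-]; exact: le1. Qed.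

Lemma sup_i01_ge0 (S : set {i01 R}) : 0 <= sup [set a%:num | a in S].
Proof.
have [->|/set0P[a Sa]] := eqVneq S set0; first by rewrite image_set0 sup0.
apply: le_trans (ge0 a) _; apply: ub_le_sup; last by exists a.
by exists 1; exact: ubound_i01.
Qed.

Lemma sup_i01_le1 (S : set {i01 R}) : sup [set a%:num | a in S] <= 1.
Proof.
have [->|S0] := eqVneq S set0; first by rewrite image_set0 sup0.
apply: ge_sup; last exact: ubound_i01.
by apply/image_nonempty/set0P.
Qed.

(* The supremum in [0, 1]; sup set0 = 0 is also the right value there. *)
Definition sup_i01 (S : set {i01 R}) : {i01 R} :=
  Itv01 (sup_i01_ge0 S) (sup_i01_le1 S).

Definition fsup (T : Type) (F : T -> fuzzy_set R X) : fuzzy_set R X :=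
  fun x => sup_i01 [set F t x | t in [set: T]].

Lemma fsup_ub (T : Type) (F : T -> fuzzy_set R X) t : (F t <= fsup F)%O.
Proof.
apply/lefP => x; rewrite -num_le /=; apply: ub_le_sup.
  by exists 1; exact: ubound_i01.
by exists (F t x) => //; exists t.
Qed.

Lemma fsup_le (T : Type) (F : T -> fuzzy_set R X) (g : fuzzy_set R X) :
  (forall t, (F t <= g)%O) -> (fsup F <= g)%O.
Proof.
move=> Fg; apply/lefP => x; rewrite -num_le /=.
set S := (X in sup X); have [->|S0] := eqVneq S set0.
  by rewrite sup0; exact: ge0.
apply: ge_sup; first exact/set0P.
by move=> _ [_ [t _ <-] <-]; rewrite num_le; exact: (lefP _ _ (Fg t)).
Qed.

End FuzzySets.

Arguments fzero {R X}.
Arguments findic {R X} A.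

Record fuzzyClosure (R : realType) (X : Type) := FuzzyClosure {
  fclosure :> fuzzy_set R X -> fuzzy_set R X ;
  fcarrier_nonempty : [set: X] !=set0 ;
  fclosure0 : fclosure fzero = fzero ;
  fclosure_ext : forall f, (f <= fclosure f)%O ;
  fclosureU : forall f g,
    fclosure (f `|` g)%O = (fclosure f `|` fclosure g)%O }.

Section Urysohn.
Variables (R : realType) (X : Type) (c : fuzzyClosure R X).

Definition finterior (f : fuzzy_set R X) : fuzzy_set R X :=
  fcompl (c (fcompl f)).

Definition fnbhs (x : X) (l : {i01 R}) (f : fuzzy_set R X) : Prop :=
  (fpoint x l <= finterior f)%O.

Definition CF_Urysohn : Prop :=
  forall (x y : X) (l m : {i01 R}),
    0 < l%:num -> 0 < m%:num -> x <> y ->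
    exists f g : fuzzy_set R X,
      [/\ fnbhs x l f,
          fnbhs y m g,
          (c f <= fcompl (c g))%O,
          (fpoint x l <= f)%O /\ (f <= fcompl (fpoint y m))%O &
          (fpoint y m <= g)%O /\ (g <= fcompl (fpoint x l))%O].

End Urysohn.

Section Sum.
Variables (R : realType) (U T : Type) (X : T -> set U).

Lemma bigcup_mem t (x : X t) : \val x \in \bigcup_s X s.
Proof. by apply/mem_set; exists t => //; exact: set_mem (valP x). Qed.

Definition to_bigcup t (x : X t) : \bigcup_s X s :=
  exist _ (\val x) (bigcup_mem x).

Definition fextend t (g : fuzzy_set R (X t)) : fuzzy_set R (\bigcup_s X s) :=
  fun y => if insub (\val y) is Some x then g x else 0%:i01.

(* The part of f lying in X t: 1_{X t} /\ f, read as a fuzzy set on X t. *)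
Definition fpart t (f : fuzzy_set R (\bigcup_s X s)) : fuzzy_set R (X t) :=
  fun x => (findic [set y | X t (\val y)] `&` f)%O (to_bigcup x).
Arguments fpart t f : clear implicits.

Variable c : forall t, fuzzyClosure R (X t).

Definition fsum_op (f : fuzzy_set R (\bigcup_s X s)) :
    fuzzy_set R (\bigcup_s X s) :=
  fsup (fun t => fextend (c t (fpart t f))).

Lemma fpartE t f (x : X t) : fpart t f x = f (to_bigcup x).
Proof.
rewrite /fpart meetfE /findic mem_set /=; last exact: set_mem (valP x).
by apply/meet_idPr; rewrite -num_le; exact: le1.
Qed.

Lemma fextend_mono t (g h : fuzzy_set R (X t)) :
  (g <= h)%O -> (fextend g <= fextend h)%O.
Proof.
move=> /lefP gh; apply/lefP => y; rewrite /fextend.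
by case: insub => // x; exact: gh.
Qed.

Lemma fclosure_mono t (g h : fuzzy_set R (X t)) :
  (g <= h)%O -> (c t g <= c t h)%O.
Proof. by move=> /join_idPl gh; rewrite -gh fclosureU leUr. Qed.

Lemma fsum_op_mono f g : (f <= g)%O -> (fsum_op f <= fsum_op g)%O.
Proof.
move=> /lefP fg; apply: fsup_le => t; apply: le_trans (fsup_ub _ t).
apply/fextend_mono/fclosure_mono/lefP => x.
by rewrite !fpartE; exact: fg.
Qed.

Lemma fsum_op0 : fsum_op fzero = fzero.
Proof.
apply/le_anti/andP; split; last first.
  by apply/lefP => y; rewrite -num_le; exact: ge0.
apply: fsup_le => t; have -> : fpart t fzero = fzero.
  by apply/funext => x; rewrite fpartE.
by rewrite fclosure0; apply/lefP => y; rewrite /fextend; case: insub.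
Qed.

Lemma fsum_op_ext f : (f <= fsum_op f)%O.
Proof.
apply/lefP => y; have [t _ Xty] := set_mem (valP y).
apply: le_trans (lefP _ _ (fsup_ub _ t) y); rewrite /fextend.
case: insubP => [x _ xy|]; last by rewrite mem_set.
apply: le_trans (lefP _ _ (fclosure_ext (c t) _) x); rewrite fpartE.
by have -> // : to_bigcup x = y by apply: val_inj.
Qed.

Lemma fsum_opU f g : fsum_op (f `|` g)%O = (fsum_op f `|` fsum_op g)%O.
Proof.
apply/le_anti/andP; split; last first.
  by rewrite leUx; apply/andP; split; apply: fsum_op_mono; rewrite ?leUl ?leUr.
apply: fsup_le => t.
have -> : fpart t (f `|` g)%O = (fpart t f `|` fpart t g)%O.
  by apply/funext => x; rewrite joinfE !fpartE joinfE.
rewrite fclosureU.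
have -> : fextend (c t (fpart t f) `|` c t (fpart t g))%O =
    (fextend (c t (fpart t f)) `|` fextend (c t (fpart t g)))%O.
  apply/funext => y; rewrite joinfE /fextend; case: insub => [x|].
    by rewrite joinfE.
  by rewrite joinxx.
by apply: leU2; [exact: (fsup_ub _ t) | exact: (fsup_ub _ t)].
Qed.

Lemma bigcup_nonempty :
  [set: T] !=set0 -> [set: \bigcup_s X s] !=set0.
Proof.
by move=> [t _]; have [x _] := fcarrier_nonempty (c t); exists (to_bigcup x).
Qed.

(* T must be inhabited for the union to be a legitimate (non-empty) carrier. *)
Definition fuzzy_sum (T0 : [set: T] !=set0) : fuzzyClosure R (\bigcup_s X s) :=
  FuzzyClosure (bigcup_nonempty T0) fsum_op0 fsum_op_ext fsum_opU.

End Sum.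

Arguments fpart {R U T X} t f.

(* Main.v *)
(* The carriers are disjoint, so the sum closure restricts on each X t to c t
   (fpart_fsum).  Urysohn neighborhoods therefore restrict from the sum to the
   summands; conversely those of two points of the same X t are extended by 0,
   and points lying in distinct X t and X s are separated by the extensions of
   the constant 1, whose closures are again these extensions. *)
Require Import Defs.
From mathcomp Require Import all_boot all_order all_algebra.
From mathcomp Require Import all_classical all_reals.
From mathcomp Require Import interval_inference lra.
Import Order.TTheory GRing.Theory Num.Theory.
Local Open Scope classical_set_scope.
Local Open Scope ring_scope.

Section FuzzySetTheory.
Context {R : realType} {X : Type}.
Implicit Types (f g : fuzzy_set R X) (x y : X) (l : {i01 R}).

Lemma i01_ge0 l : (0%:i01 <= l)%O.
Proof. by rewrite -num_le; exact: ge0. Qed.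

Lemma i01_le1 l : (l <= 1%:i01)%O.
Proof. by rewrite -num_le; exact: le1. Qed.

Lemma fcomplK : involutive (@fcompl R X).
Proof.
by move=> f; apply/funext => x; apply/val_inj; rewrite /= opprB addrC subrK.
Qed.

Lemma fcompl0 : fcompl fzero = (fun=> 1%:i01) :> fuzzy_set R X.
Proof. by apply/funext => x; apply/val_inj; rewrite /= subr0. Qed.

(** Both sides say that [f x + g x <= 1] at every point. *)
Lemma le_fcomplC f g : (f <= fcompl g)%O <-> (g <= fcompl f)%O.
Proof.
by split=> /lefP fg; apply/lefP => x; move: (fg x); rewrite -!num_le /=; lra.
Qed.

Lemma fpoint_leP x l f : (fpoint x l <= f)%O <-> (l <= f x)%O.
Proof.
split=> [/lefP/(_ x)|lf]; first by rewrite /fpoint mem_set.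
apply/lefP => y; rewrite /fpoint; case: ifPn => [/set_mem ->//|_].
exact: i01_ge0.
Qed.

Lemma le_fcompl_fpointP x l f :
  (f <= fcompl (fpoint x l))%O <-> (l <= fcompl f x)%O.
Proof. by rewrite le_fcomplC; exact: fpoint_leP. Qed.

Lemma fclosure1 (c : fuzzyClosure R X) : c (fun=> 1%:i01) = (fun=> 1%:i01).
Proof.
apply/funext => x; apply/le_anti; rewrite i01_le1 /=.
exact: (lefP _ _ (fclosure_ext c (fun=> 1%:i01)) x).
Qed.

(** The complement of the constant 1 is [fzero], which [c] fixes. Hence the constant 1 is a
    neighborhood of every fuzzy point. *)
Lemma finterior1 (c : fuzzyClosure R X) :
  finterior c (fun=> 1%:i01) = (fun=> 1%:i01).
Proof. by rewrite /finterior -fcompl0 fcomplK fclosure0. Qed.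

(** This form has only values at points, and these can be carried between the sum and a summand by
    [fpart]. *)
Lemma CF_UrysohnP (c : fuzzyClosure R X) :
  CF_Urysohn c <->
  forall x y (l m : {i01 R}), 0 < l%:num -> 0 < m%:num -> x <> y ->
  exists f g, [/\ (l <= finterior c f x)%O, (m <= finterior c g y)%O,
    forall z, (c f z <= fcompl (c g) z)%O,
    (l <= f x)%O /\ (m <= fcompl f y)%O & (m <= g y)%O /\ (l <= fcompl g x)%O].
Proof.
split=> H x y l m l0 m0 xy; have [f [g [fx gy fg [xf fy] [yg gx]]]] :=
    H x y l m l0 m0 xy; exists f, g.
  by split; [exact/fpoint_leP|exact/fpoint_leP|exact/lefP|
    split; [exact/fpoint_leP|exact/le_fcompl_fpointP]..].
by split; [exact/fpoint_leP|exact/fpoint_leP|exact/lefP|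
  split; [exact/fpoint_leP|exact/le_fcompl_fpointP]..].
Qed.

End FuzzySetTheory.

Section SumTheory.
Context {R : realType} {U T : Type} {X : T -> set U}.
Hypothesis Xdisj : trivIset [set: T] X.

Lemma to_bigcup_surj (z : \bigcup_s X s) :
  exists t (x : X t), z = to_bigcup x.
Proof.
have [t _ Xtz] := set_mem (valP z).
by exists t, (exist _ (\val z) (mem_set Xtz)); apply/val_inj.
Qed.

Lemma to_bigcup_inj t : injective (@to_bigcup U T X t).
Proof. by move=> x y /(congr1 val) /= xy; exact: val_inj. Qed.

Lemma fextendE t (g : fuzzy_set R (X t)) x : fextend g (to_bigcup x) = g x.
Proof. by rewrite /fextend /= valK. Qed.

(** If the default value 0 were not taken, the point would lie in both [X t] and [X s]. Disjointness
    enters the proof here. *)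
Lemma fextend_neq t s (g : fuzzy_set R (X t)) (x : X s) :
  t <> s -> fextend g (to_bigcup x) = 0%:i01.
Proof.
move=> ts; rewrite /fextend insubF //; apply: contra_notF ts => Xtx.
apply: (Xdisj t s) => //; exists (\val x).
by split; [exact: set_mem Xtx|exact: set_mem (valP x)].
Qed.

Lemma fpart_fextend t (g : fuzzy_set R (X t)) : fpart t (fextend g) = g.
Proof. by apply/funext => x; rewrite fpartE fextendE. Qed.

Lemma fpart_fextend_neq t s (g : fuzzy_set R (X t)) :
  t <> s -> fpart s (fextend g) = fzero.
Proof. by move=> ts; apply/funext => x; rewrite fpartE fextend_neq. Qed.

Lemma fpart_fcompl t (f : fuzzy_set R (\bigcup_s X s)) :
  fpart t (fcompl f) = fcompl (fpart t f).
Proof. by apply/funext => x; rewrite /fcompl !fpartE. Qed.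

Variables (c : forall t, fuzzyClosure R (X t)) (T0 : [set: T] !=set0).
Let C := fuzzy_sum c T0.

Lemma fpart_fsum t f : fpart t (C f) = c t (fpart t f).
Proof.
apply/funext => x; rewrite fpartE; apply/le_anti/andP; split; last first.
  have /lefP/(_ (to_bigcup x)) :=
    fsup_ub (fun s => fextend (c s (fpart s f))) t.
  by rewrite fextendE.
(* Bound C f by the function equal to c t (fpart t f) on X t and 1 elsewhere. *)
pose h := fcompl (fextend (fcompl (c t (fpart t f)))).
suff /lefP/(_ (to_bigcup x)) : (C f <= h)%O.
  by rewrite /h -[leRHS]fpartE fpart_fcompl fpart_fextend fcomplK.
apply: fsup_le => s; apply/lefP => y; have [r [z ->]] := to_bigcup_surj y.
rewrite -[leRHS]fpartE /h fpart_fcompl.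
have [->|tr] := pselect (t = r); last first.
  by rewrite fpart_fextend_neq // fcompl0; exact: i01_le1.
rewrite fpart_fextend fcomplK.
(* On [X t] the supremum has a single contributing term, the one with index [t]; the others vanish
   there. *)
have [->|sr] := pselect (s = r); first by rewrite fextendE.
by rewrite fextend_neq //; exact: i01_ge0.
Qed.

Lemma fsumE t f (x : X t) : C f (to_bigcup x) = c t (fpart t f) x.
Proof. by rewrite -fpart_fsum fpartE. Qed.

(** Restriction to [X t] commutes with complement and with closure, hence with their composite. *)
Lemma finterior_fsumE t f (x : X t) :
  finterior C f (to_bigcup x) = finterior (c t) (fpart t f) x.
Proof. by rewrite /finterior -fpartE fpart_fcompl fpart_fsum fpart_fcompl. Qed.

Lemma fcomplE_part t f (x : X t) :
  @fcompl R _ f (to_bigcup x) = fcompl (fpart t f) x.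
Proof. by rewrite -fpartE fpart_fcompl. Qed.

(** Distinct points of [X t] stay distinct in the union, and the neighborhoods found there are
    restricted by [fpart t]. *)
Lemma CF_Urysohn_summand t : CF_Urysohn C -> CF_Urysohn (c t).
Proof.
move=> /CF_UrysohnP H; apply/CF_UrysohnP => x y l m l0 m0 xy.
have [|f [g [fx gy fg [xf fy] [yg gx]]]] :=
  H (to_bigcup x) (to_bigcup y) l m l0 m0.
  by move=> /to_bigcup_inj.
exists (fpart t f), (fpart t g); split.
- by rewrite -finterior_fsumE.
- by rewrite -finterior_fsumE.
- by move=> z; move: (fg (to_bigcup z)); rewrite fsumE fcomplE_part fpart_fsum.
- by rewrite fpartE -fcomplE_part.
- by rewrite fpartE -fcomplE_part.
Qed.

Lemma CF_Urysohn_fsum : (forall t, CF_Urysohn (c t)) -> CF_Urysohn C.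
Proof.
move=> H; apply/CF_UrysohnP => x' y' l m l0 m0.
have [t [x ->]] := to_bigcup_surj x'; have [s [y ->]] := to_bigcup_surj y'.
have [ts|ts] := pselect (t = s).
  subst s => xy; have [|f [g [fx gy fg [xf fy] [yg gx]]]] :=
    (CF_UrysohnP (c t)).1 (H t) x y l m l0 m0; first by move=> e; rewrite e in xy.
  exists (fextend f), (fextend g).
  split; rewrite ?finterior_fsumE ?fcomplE_part ?fextendE ?fpart_fextend //.
  move=> z'; have [r [z ->]] := to_bigcup_surj z'.
  rewrite fsumE fcomplE_part fpart_fsum.
  (* Outside [X t] both extensions, and so their closures, are 0. *)
  have [tr|tr] := pselect (t = r); first by subst r; rewrite !fpart_fextend.
  by rewrite !fpart_fextend_neq // fclosure0; exact: i01_ge0.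
move=> _; have st : s <> t by move=> /esym.
(* These are the indicators of [X t] and [X s]. Each has interior 1 on its own summand, which suits
   every [l] and [m], and complement 1 on the other. *)
exists (@fextend R U T X t (fun=> 1%:i01)), (@fextend R U T X s (fun=> 1%:i01)).
split; rewrite ?finterior_fsumE ?fcomplE_part ?fextendE ?fpart_fextend
  ?finterior1 ?i01_le1 ?(fpart_fextend_neq _ _ _ ts)
  ?(fpart_fextend_neq _ _ _ st) ?fcompl0 ?i01_le1 //.
move=> z'; have [r [z ->]] := to_bigcup_surj z'.
rewrite fsumE fcomplE_part fpart_fsum.
(* On [X t] the closure of the second indicator is 0, so its complement is 1; off [X t] the closure
   of the first is 0. *)
have [tr|tr] := pselect (t = r).
  subst r; rewrite (fpart_fextend_neq _ _ _ st) fclosure0 fcompl0.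
  exact: i01_le1.
by rewrite fpart_fextend_neq // fclosure0; exact: i01_ge0.
Qed.

End SumTheory.

Theorem theorem6p7 (R : realType) (U T : Type) (X : T -> set U)
    (T0 : [set: T] !=set0) (Xdisj : trivIset [set: T] X)
    (c : forall t : T, fuzzyClosure R (X t)) :
  CF_Urysohn (fuzzy_sum c T0) <-> forall t : T, CF_Urysohn (c t).
Proof.
by split=> [H t|]; [exact: CF_Urysohn_summand H|exact: CF_Urysohn_fsum].
Qed.
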